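(* Let $f:\mathbb{N}_+\to\mathbb{R}_+$ and suppose there exists $n_0\in\mathbb{N}_+$ such that the sequence $(f(n))_{n\geq n_0}$ is log-concave, i.e. $f(n)^2>f(n-1)f(n+1)$ for all integers $n\geq n_0+1$, and $$\limsup_{n\to\infty}\frac{f(n+n_0)}{f(n)}<f(n_0).$$ Then $f(a)f(b)>f(a+b)$ holds for all sufficiently large $a,b\in\mathbb{N}_+$.
   Context: $\mathbb{N}_+$ denotes the set of positive integers and $\mathbb{R}_+=(0,+\infty)$. *)

(* Defs.v *)
From Stdlib Require Export Reals.
From Coquelicot Require Export Coquelicot.

(* Main.v *)
Require Import Defs.
From Stdlib Require Import Reals Lia Lra Psatz.
From Coquelicot Require Import Coquelicot.
Open Scope R_scope.

(** Log-concavity makes [n |-> f (n + 1) / f n] nonincreasing from [n0] on, hence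
    [a |-> f (a + b) / f a] is nonincreasing for [a >= n0] and every [b].  Comparing
    with [a = n0] gives [f (a + b) / f a <= f (n0 + b) / f n0], and the limsup
    condition makes the right-hand side smaller than [f b] for large [b]. *)

Lemma LimSup_seq_lt_eventually (u : nat -> R) (M : R) :
  Rbar_lt (LimSup_seq u) (Finite M) ->
  exists N : nat, forall n : nat, (N <= n)%nat -> u n < M.
Proof.
  unfold LimSup_seq.
  destruct (ex_LimSup_seq u) as [[l | |] H]; simpl in *; intros Hl.
  - assert (He : 0 < M - l) by lra.
    destruct (H (mkposreal _ He)) as [_ [N HN]]; simpl in HN.
    exists N; intros n Hn; specialize (HN n Hn); lra.
  - contradiction.
  - exact (H M).
Qed.

Section LogConcave.

Variables (f : nat -> R) (n0 : nat).
Hypothesis f_pos : forall n : nat, (n0 <= n)%nat -> 0 < f n.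
Hypothesis f_lc : forall n : nat, (n0 <= n)%nat -> f n * f (S (S n)) <= f (S n) ^ 2.

(** Monotonicity of the successive ratios, cross-multiplied to avoid division. In the induction
    step, log-concavity at [n + k] is multiplied by [f n] and the induction hypothesis by
    [f (S (n + k))]. *)
Lemma log_concave_succ_ratio_le (n k : nat) : (n0 <= n)%nat ->
  f (S (n + k)) * f n <= f (n + k)%nat * f (S n).
Proof.
  intros Hn; induction k as [| k IH].
  - rewrite Nat.add_0_r; lra.
  - rewrite Nat.add_succ_r.
    assert (H0 : 0 < f (n + k)%nat) by (apply f_pos; lia).
    assert (H1 : 0 < f (S (n + k))) by (apply f_pos; lia).
    assert (H2 : 0 < f n) by (apply f_pos; lia).
    assert (Hlc := f_lc (n + k) ltac:(lia)).
    apply Rmult_le_reg_l with (1 := H0).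
    apply Rle_trans with (f (S (n + k)) ^ 2 * f n); nra.
Qed.

Lemma log_concave_shift_ratio_le (a b : nat) : (n0 <= a)%nat ->
  f (a + b)%nat * f n0 <= f (n0 + b)%nat * f a.
Proof.
  intros Ha; induction Ha as [| a Ha IH]; [lra |].
  assert (H0 : 0 < f a) by (apply f_pos; lia).
  assert (H1 : 0 < f (S a)) by (apply f_pos; lia).
  assert (H2 : 0 < f n0) by (apply f_pos; lia).
  assert (Hr := log_concave_succ_ratio_le a b Ha).
  (* After multiplying by [f a], the ratio bound replaces [f (S a + b) * f a] by
     [f (a + b) * f (S a)], to which the induction hypothesis applies. *)
  apply Rmult_le_reg_r with (1 := H0); simpl.
  apply Rle_trans with (f (a + b)%nat * f n0 * f (S a)); nra.
Qed.

End LogConcave.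

(* f : N_+ -> R_+ is a function on nat that is positive at positive arguments;
   f 0 is unconstrained and affects neither the limsup nor anything else. *)
Theorem theorem4p1 (f : nat -> R)
  (f_pos : forall n : nat, (1 <= n)%nat -> 0 < f n)
  (n0 : nat) (n0_pos : (1 <= n0)%nat)
  (f_logconcave : forall n : nat, (n0 + 1 <= n)%nat ->
     f n ^ 2 > f (n - 1)%nat * f (n + 1)%nat)
  (f_limsup : Rbar_lt (LimSup_seq (fun n : nat => f (n + n0)%nat / f n))
                      (Finite (f n0))) :
  exists N : nat, (1 <= N)%nat /\
    forall a b : nat, (N <= a)%nat -> (N <= b)%nat ->
      f a * f b > f (a + b)%nat.
Proof.
  destruct (LimSup_seq_lt_eventually _ _ f_limsup) as [N HN].
  assert (pos : forall n, (n0 <= n)%nat -> 0 < f n) by (intros; apply f_pos; lia).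
  assert (lc : forall n, (n0 <= n)%nat -> f n * f (S (S n)) <= f (S n) ^ 2).
  { intros n Hn.
    assert (H := f_logconcave (S n) ltac:(lia)).
    replace (S n - 1)%nat with n in H by lia.
    replace (S n + 1)%nat with (S (S n)) in H by lia.
    lra. }
  (* The summand [N] serves the limsup bound at [b]; [n0] puts [a] in the log-concave range and
     makes the threshold positive. *)
  exists (N + n0)%nat; split; [lia |].
  intros a b Ha Hb.
  assert (Hsh := log_concave_shift_ratio_le f n0 pos lc a b ltac:(lia)).
  assert (Hlim := HN b ltac:(lia)); simpl in Hlim.
  assert (Pa : 0 < f a) by (apply f_pos; lia).
  assert (Pb : 0 < f b) by (apply f_pos; lia).
  assert (P0 : 0 < f n0) by (apply f_pos; lia).
  apply Rlt_div_l in Hlim; [| exact Pb].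
  rewrite (Nat.add_comm b n0) in Hlim.
  (* The chain is [f (a + b) * f n0 <= f (n0 + b) * f a < f n0 * f b * f a]. *)
  apply Rmult_lt_reg_r with (1 := P0).
  apply Rle_lt_trans with (1 := Hsh); nra.
Qed.
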